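(* Let $X$ be a random variable taking values in the $\sigma$-finite measure space $(\mathcal X,\mathscr X,\mu)$, with distribution $\mu_X\ll\mu$ and $$\Sigma_p(X):=\left\|\frac{\mathrm d\mu_X}{\mathrm d\mu}\right\|^{(\mu)}_{p/(p-1)}<\infty\quad\text{with } p\in[1,\infty).$$ Let $(\mathcal Y,\mathscr Y)$ be a measurable space and let $\rho\colon\mathcal X\times\mathcal Y\to[0,\infty]$ be a distortion function. Let $k\in(0,\infty)$ and suppose that $\mu$ is $\rho^{1/k}$-subregular of dimension $m\in(0,\infty)$ with subregularity constants $c\in(0,\infty)$ and $\delta_0\in(0,\infty]$. Then $V_n(X)\ge L_n(X)$ for all $n\in\mathbb N$, where $$L_n(X)=\min\left\{c^{-\frac km}\,\Sigma_p^{-\frac{pk}{m}}(X)\,n^{-\frac{pk}{m}},\ \delta_0^k\right\}\frac{m}{m+pk}.$$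
   Context: All measures are positive, and $\sigma$-algebras contain all singletons. A distortion function $\rho\colon\mathcal X\times\mathcal Y\to[0,\infty]$ is a function measurable with respect to the product $\sigma$-algebra. For a distortion function $\varrho$ on $\mathcal X\times\mathcal Y$, a measure $\mu$ on $(\mathcal X,\mathscr X)$ is $\varrho$-subregular of dimension $m\in[0,\infty)$ with subregularity constants $c\in(0,\infty)$ and $\delta_0\in(0,\infty]$ if $\mu(\{x\in\mathcal X:\varrho(x,y)<\delta\})\le c\,\delta^m$ for all $y\in\mathcal Y$ and $\delta\in(0,\delta_0)$. $\|f\|_q^{(\mu)}=\left(\int|f|^q\,\mathrm d\mu\right)^{1/q}$ for $q\in(0,\infty)$, and $\|f\|_\infty^{(\mu)}$ is the $\mu$-essential supremum of $|f|$; for $p=1$, $p/(p-1)$ is read as $\infty$. $\Sigma_p^{a}(X)$ means $(\Sigma_p(X))^a$. $\infty^k=\infty$. $n$-th quantization error: $V_n(X)=\inf_{f\in\mathcal F_n(\mathcal X,\mathcal Y)}\mathbb E[\rho(X,f(X))]$, where $\mathcal F_n(\mathcal X,\mathcal Y)$ is the set of measurable maps $f\colon\mathcal X\to\mathcal Y$ with $|f(\mathcal X)|\le n$. The infimum of the empty set is $\infty$. *)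

(* Defs.v *)
From HB Require Import structures.
From mathcomp Require Import all_boot all_order all_algebra.
From mathcomp Require Import all_classical all_reals all_analysis.
From mathcomp Require Import measurable_realfun.

Set Implicit Arguments.
Unset Strict Implicit.
Unset Printing Implicit Defensive.

Import Order.TTheory GRing.Theory Num.Theory.

Local Open Scope classical_set_scope.
Local Open Scope ring_scope.
Local Open Scope charge_scope.
Local Open Scope ereal_scope.

Definition distortion (dX dY : measure_display) (TX : measurableType dX)
    (TY : measurableType dY) (R : realType) (rho : TX * TY -> \bar R) : Prop :=
  (forall z, 0 <= rho z) /\ measurable_fun [set: TX * TY] rho.

Definition subregular (dX : measure_display) (TX : measurableType dX)
    (TY : Type) (R : realType) (mu : {measure set TX -> \bar R})
    (rho : TX * TY -> \bar R) (m c : R) (delta0 : \bar R) : Prop :=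
  [/\ (0 <= m)%R, (0 < c)%R, 0 < delta0 &
      forall (y : TY) (delta : R), (0 < delta)%R -> delta%:E < delta0 ->
        mu [set x | rho (x, y) < delta%:E] <= (c * delta `^ m)%:E].

(* Since hoelder_conjugate p%:E = p%:E / (p%:E - 1) in \bar R, it is +oo for
   p = 1, and Lnorm is then the essential supremum. The Radon-Nikodym
   derivative is the density only under the hypothesis distribution P X `<< mu
   (it is a dummy value otherwise). *)
Definition Sigma (d dX : measure_display) (T : measurableType d)
    (TX : measurableType dX) (R : realType) (P : probability T R)
    (X : {RV P >-> TX}) (mu : {sigma_finite_measure set TX -> \bar R})
    (p : R) : \bar R :=
  'N[mu]_(hoelder_conjugate p%:E)
    ['d (charge_of_finite_measure (distribution P X)) '/d mu].

Definition quantizers (dX dY : measure_display) (TX : measurableType dX)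
    (TY : measurableType dY) (n : nat) : set (TX -> TY) :=
  [set f | measurable_fun [set: TX] f /\ (range f #<= `I_n)%card].

(* The expectation is written as an integral because 'E_P is restricted to
   real-valued functions while rho may take the value +oo. *)
Definition quantization_error (d dX dY : measure_display)
    (T : measurableType d) (TX : measurableType dX) (TY : measurableType dY)
    (R : realType) (P : probability T R) (X : {RV P >-> TX})
    (rho : TX * TY -> \bar R) (n : nat) : \bar R :=
  ereal_inf [set \int[P]_w rho (X w, f (X w)) |
             f in @quantizers dX dY TX TY n].

(* Pitfall: in the library 0 `^ a = 0 and +oo `^ a = +oo also for a < 0. Negative
   powers are meant here for 0 < S < +oo and 0 < n only; S = Sigma X mu p is
   positive as the norm of a probability density. *)
Definition lower_bound (R : realType) (S : \bar R) (p k m c : R)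
    (delta0 : \bar R) (n : nat) : \bar R :=
  mine ((c `^ (- (k / m)))%:E * S `^ (- (p * k / m))
          * (n%:R `^ (- (p * k / m)))%:E)
       (delta0 `^ k)
  * (m / (m + p * k))%:E.

(* Main.v *)
Require Import Defs.
From HB Require Import structures.
From mathcomp Require Import all_boot all_order all_algebra.
From mathcomp Require Import all_classical all_reals all_analysis.
From mathcomp Require Import measurable_realfun ess_sup_inf ring.

Set Implicit Arguments.
Unset Strict Implicit.
Unset Printing Implicit Defensive.

Import Order.TTheory GRing.Theory Num.Theory numFieldNormedType.Exports.

Local Open Scope classical_set_scope.
Local Open Scope ring_scope.
Local Open Scope charge_scope.
Local Open Scope ereal_scope.

(** The bound says that a law with a density in L^(p/(p-1)) cannot put much
    mass close to n points. Let f be a quantizer with at most n values and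
    h x = rho (x, f x). For u > 0 the set {h < u} is covered by n balls of
    radius u^(1/k) for rho^(1/k), so subregularity bounds its mu-measure by
    n c u^(m/k) as long as u < delta0^k
    ([measure_finite_range_section_le]). Hoelder's inequality applied to the
    density against the indicator of this set
    ([dominated_measure_le_Lnorm]) turns this into
      P(h(X) < u) <= Sigma (n c u^(m/k))^(1/p) <= (u/s)^a,  a = m/(pk),
    where s = c^(-k/m) Sigma^(-pk/m) n^(-pk/m) is the first term of the minimum
    ([scaled_ball_bound_le]). The second inequality replaces n^(1/p) by n. Here
    Sigma > 0; the bound is trivially 0 otherwise.

    So the distribution function of the nonnegative variable h(X) is at most
    (u/s)^a on ]0, t[ with t = min(s, delta0^k), and integrating its tail over
    [0, t] gives
      E h(X) >= \int_0^t (1 - (u/s)^a) du = t - t (t/s)^a / (1+a)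
             >= t a / (1+a) = t m / (m + pk)
    ([le_integral_of_cdf_powR]), because t <= s. Taking the infimum over f
    concludes. *)

(** * A tail bound for nonnegative random variables *)

Lemma integral_onem_powR (R : realType) (a s t : R) :
    (0 < a)%R -> (0 < s)%R -> (0 < t)%R ->
  \int[lebesgue_measure]_(r in `[0%R, t]) (1 - (r / s) `^ a)%:E =
  (t - t / (1 + a) * (t / s) `^ a)%:E.
Proof.
move=> a0 s0 t0.
have a10 : (0 < 1 + a)%R by apply: addr_gt0.
have sa0 : (s `^ a != 0)%R by rewrite gt_eqF// powR_gt0.
have powd (b r : R) : (0 < r)%R -> derivable (@powR R ^~ b) r 1%R.
  by move=> r0; apply: ex_derive; exact: is_derive1_powR.
(* At 0 the power function is only right-continuous, powers of negative reals
   being 1, so continuity and differentiability are kept inside [0, t]. *)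
have pow_cont (b : R) : (0 < b)%R ->
    derivable_oo_LRcontinuous (fun r : R => r `^ b)%R 0 t.
  move=> b0; split.
  - by move=> r; rewrite in_itv/= => /andP[r0 _]; exact: powd.
  - by rewrite powR0 ?gt_eqF//; exact: powR_cvg0.
  - apply: cvg_at_left_filter.
    by have /derivable1_diffP/differentiable_continuous := powd b t t0.
pose F := (fun r : R => r - (s `^ a * (1 + a))^-1 * r `^ (1 + a))%R.
pose f := (fun r : R => 1 - (s `^ a)^-1 * r `^ a)%R.
have fE (r : R) : r \in `[0%R, t]%classic -> (1 - (r / s) `^ a = f r)%R.
  rewrite inE/= in_itv/= => /andP[r0 _].
  rewrite /f powRM// ?invr_ge0 ?(ltW s0)//.
  by rewrite -(powR_inv1 (ltW s0)) -powRrM mulN1r powRN mulrC.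
under eq_integral => r rt do rewrite fE//.
rewrite (@continuous_FTC2 _ f F)//.
- rewrite -EFinB /F; congr EFin.
  rewrite powR0 ?gt_eqF// mulr0 !subr0; congr (_ - _)%R.
  rewrite powRM ?invr_ge0 ?(ltW s0) ?(ltW t0)//.
  rewrite powRD; last by rewrite gt_eqF.
  rewrite powRr1 ?ltW//.
  rewrite -(powR_inv1 (ltW s0)) -powRrM mulN1r powRN.
  by field; rewrite sa0 gt_eqF.
- move=> r; apply: cvgB; first exact: cvg_cst.
  apply: cvgMr; exact: (derivable_oo_LRcontinuous_within (pow_cont a a0)).
- have [dp p0 pt] := pow_cont _ a10; split.
  + by move=> r rt; apply: derivableB => //; apply: derivableM => //; exact: dp.
  + apply: cvgB; first exact: cvg_at_right_filter.
    exact: cvgMr.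
  + apply: cvgB; first exact: cvg_at_left_filter.
    exact: cvgMr.
- move=> r; rewrite in_itv/= => /andP[r0 _].
  have ? := is_derive1_powR (1 + a) r0.
  rewrite derive1E /F derive_val /f /GRing.scale/=.
  rewrite (_ : (1 + a - 1 = a)%R); last by ring.
  by field; rewrite sa0 gt_eqF.
Qed.

(** Right-continuity of a power function at r, in the form in which a bound on
    {Z < u} for all u > r passes to {Z <= r}. *)
Lemma le_powR_of_right_nbhd (R : realType) (a s r t x : R) :
    (0 < a)%R -> (0 < s)%R -> (0 <= r < t)%R -> (0 <= x)%R ->
    (forall u : R, (r < u < t)%R -> (x <= (u / s) `^ a)%R) ->
  (x <= (r / s) `^ a)%R.
Proof.
move=> a0 s0 /andP[r0 rt] x0 xle.
(* y is the point where (y / s) `^ a = x; it cannot exceed r. *)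
pose y := (s * x `^ a^-1)%R.
have y0 : (0 <= y)%R by rewrite mulr_ge0 ?powR_ge0// ltW.
have yx : ((y / s) `^ a = x)%R.
  by rewrite /y mulrAC divff ?gt_eqF// mul1r -powRrM mulVf ?gt_eqF// powRr1.
have yr : (y <= r)%R.
  rewrite leNgt; apply/negP => ry.
  have := @midf_lt _ r (Num.min y t); rewrite lt_min ry => /(_ rt).
  set u := ((r + _) / 2)%R => -[ru]; rewrite lt_min => /andP[uy ut].
  have := xle u; rewrite ru ut => /(_ isT).
  rewrite -yx leNgt gt0_ltr_powR// ?nnegrE.
  - by rewrite divr_ge0// ltW// (le_lt_trans r0).
  - by rewrite divr_ge0// ltW.
  - by rewrite ltr_pM2r ?invr_gt0.
rewrite -yx ge0_ler_powR ?nnegrE ?(ltW a0)// ?divr_ge0 ?(ltW s0)//.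
by rewrite ler_pM2r ?invr_gt0.
Qed.

(** Layer cake on [0, t]: the expectation dominates the integral of the tail
    1 - P(Z <= r), which is at least 1 - (r/s)^a there. The truncation of Z at t
    makes the variable real-valued, as the tail formula requires, and does not
    change the events {Z <= r} with r < t. *)
Lemma le_integral_of_cdf_powR d (T : measurableType d) (R : realType)
    (P : probability T R) (Z : T -> \bar R) (a s t : R) :
    measurable_fun [set: T] Z -> (forall w, 0 <= Z w) ->
    (0 < a)%R -> (0 < s)%R -> (0 < t <= s)%R ->
    (forall u : R, (0 < u < t)%R ->
      P [set w | Z w < u%:E] <= ((u / s) `^ a)%:E) ->
  (t * (a / (1 + a)))%:E <= \int[P]_w Z w.
Proof.
move=> mZ Z0 a0 s0 /andP[t0 ts] cdfZ.
pose X' := fun w => fine (mine (Z w) t%:E).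
have X'E w : (X' w)%:E = mine (Z w) t%:E.
  rewrite fineK// ge0_fin_numE; first by rewrite gt_min ltry orbT.
  by rewrite le_min Z0 lee_fin ltW.
have mX' : measurable_fun setT X'.
  by apply: measurableT_comp => //; apply: measurable_mine.
pose X : {RV P >-> R} := mfun_Sub (mem_set mX').
have X0 w : (0 <= X w)%R by rewrite -lee_fin X'E le_min Z0 lee_fin ltW.
apply: (@le_trans _ _ ('E_P[X])); last first.
  rewrite expectation_def; apply: ge0_le_integral => //.
  - by move=> w _; rewrite lee_fin.
  - exact/measurable_EFinP.
  - by move=> w _; rewrite /= X'E ge_min lexx.
rewrite ge0_expectation_ccdf//.
apply: (@le_trans _ _
  (\int[lebesgue_measure]_(r in `[0%R, t[) ccdf X r)); last first.
  apply: ge0_subset_integral => //=.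
  - exact: measurable_funTS (ccdf_measurable X).
  - by apply: subset_itvl.
have mccdf := ccdf_measurable X.
have cdfX (r : R) : (0 <= r < t)%R -> cdf X r <= ((r / s) `^ a)%:E.
  move=> /andP[r0 rt].
  have cdf_le u : (r < u < t)%R -> cdf X r <= ((u / s) `^ a)%:E.
    move=> /andP[ru ut].
    have u0 : (0 < u)%R by exact: le_lt_trans ru.
    apply: le_trans (cdfZ u _); last by rewrite u0.
    rewrite /cdf /distribution /pushforward; apply: le_measure; rewrite ?inE//.
    - exact: (measurable_funPTI X).
    - rewrite -[X in measurable X]setTI.
      exact: (emeasurable_fun_infty_o measurableT mZ).
    - move=> w /=; rewrite in_itv/= -lee_fin X'E ge_min => /orP[Zr|].
        by apply: le_lt_trans Zr _; rewrite lte_fin.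
      by rewrite lee_fin leNgt rt.
  have cdf_fin : cdf X r \is a fin_num by exact: fin_num_measure.
  rewrite -(fineK cdf_fin) lee_fin.
  apply: (@le_powR_of_right_nbhd _ _ _ _ t) => //.
  - by rewrite r0.
  - exact: fine_ge0.
  - by move=> u rut; rewrite -lee_fin fineK//; exact: cdf_le.
have pow_le1 (u : R) : (0 <= u <= s)%R -> ((u / s) `^ a <= 1)%R.
  move=> /andP[u0 us]; have := @ge0_ler_powR _ a (ltW a0) (u / s)%R 1%R.
  rewrite powR1; apply; rewrite ?nnegrE ?divr_ge0 ?(ltW s0)//.
  by rewrite ler_pdivrMr// mul1r.
have mpow : measurable_fun `[0%R, t[ (fun r : R => (1 - (r / s) `^ a)%:E).
  apply/measurable_EFinP; apply: measurable_funB => //.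
  apply: measurable_funTS.
  apply: (@measurableT_comp _ _ _ _ _ _ (@powR R ^~ a)) => //.
  exact: measurable_funM.
apply: (@le_trans _ _
    (\int[lebesgue_measure]_(r in `[0%R, t[) (1 - (r / s) `^ a)%:E)).
  rewrite integral_itv_bndo_bndc// integral_onem_powR// lee_fin.
  have a10 : (0 < 1 + a)%R by apply: addr_gt0.
  rewrite [leLHS](_ : _ = t - t / (1 + a) * 1)%R; last first.
    by field; rewrite gt_eqF.
  rewrite lerB// ler_pM2l ?divr_gt0//.
  by apply: pow_le1; rewrite ltW.
apply: ge0_le_integral => //=.
- move=> r; rewrite in_itv/= => /andP[r0 rt]; rewrite lee_fin subr_ge0.
  by apply: pow_le1; rewrite r0 ltW// (lt_le_trans rt).
- exact: measurable_funTS.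
- move=> r; rewrite in_itv/= => rt; rewrite ccdf_1_cdf EFinB leeB//.
  exact: cdfX.
Qed.

(** * Mass of a set under a dominated measure *)

(** Hoelder's inequality against the indicator of A, whose p-norm is
    mu(A)^(1/p). For p = 1 the norm is an essential supremum, set to 0
    when mu is the zero measure, so this case is treated by hand. *)
Lemma integral_abse_le_Lnorm d (T : measurableType d) (R : realType)
    (mu : {measure set T -> \bar R}) (f : T -> \bar R) (p : R) (A : set T) :
    measurable_fun [set: T] f -> (forall x, f x \is a fin_num) ->
    (1 <= p)%R -> measurable A ->
  \int[mu]_(x in A) `|f x| <=
  'N[mu]_(hoelder_conjugate p%:E)[f] * mu A `^ p^-1.
Proof.
move=> mf ffin p1 mA.
have [->|pn1] := eqVneq p 1%R.
  rewrite hoelder_conjugate1 invr1 poweRe1//.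
  have [T0|muT] := eqVneq (mu [set: T]) 0.
    have A0 : mu A = 0 by exact: (subset_measure0 mA measurableT).
    rewrite null_set_integral ?A0 ?mule0//; apply: measurableT_comp => //.
    exact: measurable_funTS.
  have muT0 : 0 < mu [set: T] by rewrite lt0e muT /=.
  have N0 := Lnorm_ge0 mu +oo f.
  have NE : 'N[mu]_+oo[f] = ess_sup mu (abse \o f) by rewrite unlock /= muT0.
  rewrite -integral_cst//; apply: ae_ge0_le_integral => //.
  - by apply: measurableT_comp => //; exact: measurable_funTS.
  - rewrite /cst /= NE; have := ess_sup_ge mu (abse \o f).
    by apply: filterS => x.
have p_gt1 : (1 < p)%R by rewrite lt_neqAle eq_sym pn1.
have p0 : (0 < p)%R by exact: lt_trans p_gt1.
have pB1 : (0 < p - 1)%R by rewrite subr_gt0.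
have pcE : hoelder_conjugate p%:E = (p / (p - 1))%:E.
  rewrite /hoelder_conjugate/= eqe gt_eqF//.
  by rewrite -EFinB inver gt_eqF// -EFinM.
have fE : f = EFin \o (fine \o f) by apply/funext => x /=; rewrite fineK.
have NA : 'N[mu]_p%:E[EFin \o \1_A] = mu A `^ p^-1.
  rewrite unlock /= -[in RHS](setIT A) -integral_indic//; congr (_ `^ _).
  apply: eq_integral => x _; rewrite indicE.
  by case: (x \in A) => /=; rewrite ?normr1 ?normr0 ?powR1 ?powR0 ?gt_eqF.
have := @hoelder _ _ _ mu (fine \o f) \1_A (p / (p - 1)) p.
rewrite -fE -pcE => H.
have mfine : measurable_fun [set: T] (fine \o f) by exact: measurableT_comp.
apply: (le_trans _ (le_trans (H _ _ _ _ _) _)) => //.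
- rewrite Lnorm1 integral_mkcond le_eqVlt; apply/orP; left; apply/eqP.
  apply: eq_integral => x _; rewrite patchE /= indicE.
  case: ifPn => xA; rewrite ?xA ?(negbTE xA) /= ?mulr1 ?mulr0 ?normr0//.
  by rewrite -[in LHS](fineK (ffin x)).
- exact: divr_gt0.
- by field; rewrite !gt_eqF.
- by rewrite NA.
Qed.

(** The density is only almost everywhere nonnegative, so nu A is first bounded
    by the integral of its absolute value. *)
Lemma dominated_measure_le_Lnorm d (T : measurableType d) (R : realType)
    (nu : {finite_measure set T -> \bar R})
    (mu : {sigma_finite_measure set T -> \bar R}) (p : R) (A : set T) :
    nu `<< mu -> (1 <= p)%R -> measurable A ->
  nu A <= 'N[mu]_(hoelder_conjugate p%:E)
            ['d (charge_of_finite_measure nu) '/d mu] * mu A `^ p^-1.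
Proof.
move=> numu p1 mA.
have numu' : charge_of_finite_measure nu `<< mu by [].
set g := Radon_Nikodym _ _.
have gint : mu.-integrable setT g by exact: Radon_Nikodym_integrable.
have mg : measurable_fun setT g by exact: measurable_int gint.
have gfin x : g x \is a fin_num by exact: Radon_Nikodym_fin_num.
apply: le_trans (integral_abse_le_Lnorm mu mg gfin p1 mA).
have -> : nu A = charge_of_finite_measure nu A by [].
rewrite (Radon_Nikodym_integral numu' mA).
apply: (le_trans (lee_abs _)); apply: le_abse_integral => //.
exact: measurable_funTS.
Qed.

(** * Balls around a finite codebook *)

(** With B y the ball around y, this covers the points that are close to their
    own image under f by one ball per value of f. *)
Lemma measure_finite_range_section_le d (T : measurableType d) (R : realType)
    (mu : {measure set T -> \bar R}) (U : pointedType) (f : T -> U)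
    (B : U -> set T) (n : nat) (b : \bar R) :
    (range f #<= `I_n)%card ->
    (forall y, measurable (B y)) -> (forall y, mu (B y) <= b) ->
    measurable [set x | B (f x) x] ->
  mu [set x | B (f x) x] <= n%:R%:E * b.
Proof.
move=> /pcard_surjP[g gsurj] mB muB mBf.
apply: (@le_trans _ _ (mu (\big[setU/set0]_(i < n) B (g i)))).
  apply: le_measure; rewrite ?inE//; first exact: bigsetU_measurable.
  move=> x Bx; rewrite -(bigcup_mkord n (B \o g)).
  have [|i /= ni gi] := gsurj (f x); first by exists x.
  by exists i => //=; rewrite gi.
apply: (le_trans (@Boole_inequality _ _ _ mu (B \o g) n _)).
  by move=> i _; exact: mB.
apply: (@le_trans _ _ (\sum_(i < n) b)).
  by apply: lee_sum => i _; exact: muB.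
by rewrite sumr_const card_ord mule_natl lexx.
Qed.

(** The scale s dividing u is K^(-pk/m) for K = c^(1/p) sigma n, hence
    (u/s)^(m/(pk)) = K u^(m/(pk)); only n^(1/p) <= n is lost. *)
Lemma scaled_ball_bound_le (R : realType) (sigma c u p k m : R) (n : nat) :
    (0 < sigma)%R -> (0 < c)%R -> (0 < u)%R -> (1 <= p)%R -> (0 < k)%R ->
    (0 < m)%R -> (0 < n)%N ->
  (sigma * (n%:R * (c * (u `^ k^-1) `^ m)) `^ p^-1 <=
   (u / (c `^ (- (k / m)) * sigma `^ (- (p * k / m))
         * n%:R `^ (- (p * k / m)))) `^ (m / (p * k)))%R.
Proof.
move=> sigma0 c0 u0 p1 k0 m0 n0.
have p0 : (0 < p)%R by exact: lt_le_trans p1.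
have nR0 : (0 < n%:R :> R)%R by rewrite ltr0n.
pose K : R := (c `^ p^-1 * sigma * n%:R)%R.
have K0 : (0 < K)%R by rewrite !mulr_gt0 ?powR_gt0.
have -> : (c `^ (- (k / m)) * sigma `^ (- (p * k / m)) * n%:R `^ (- (p * k / m))
    = K `^ (- (p * k / m)))%R.
  rewrite /K !powRM ?mulr_ge0 ?powR_ge0 ?(ltW sigma0)// -powRrM.
  by congr (_ `^ _ * _ * _)%R; field; rewrite !gt_eqF.
have -> : ((u / K `^ (- (p * k / m))) `^ (m / (p * k))
    = K * u `^ (m / (p * k)))%R.
  rewrite -powRN opprK powRM ?powR_ge0 ?(ltW u0)// -powRrM mulrC.
  congr (_ * _)%R.
  rewrite (_ : (p * k / m * (m / (p * k)) = 1)%R) ?powRr1 ?(ltW K0)//.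
  by field; rewrite !gt_eqF.
have -> : (m / (p * k) = k^-1 * m * p^-1)%R by field; rewrite !gt_eqF.
rewrite [in leRHS]powRrM -powRrM.
rewrite powRM ?mulr_ge0 ?powR_ge0 ?(ltW c0)// powRM ?powR_ge0 ?(ltW c0)//.
rewrite /K [leLHS](_ : _ = c `^ p^-1 * sigma * n%:R `^ p^-1
    * (u `^ (k^-1 * m)) `^ p^-1)%R; last by ring.
rewrite ler_wpM2r ?powR_ge0// ler_wpM2l ?mulr_ge0 ?powR_ge0 ?(ltW sigma0)//.
rewrite -[leRHS]powRr1// ler_powR ?ler1n//.
by rewrite invf_le1.
Qed.

(** * The lower bound on the quantization error *)

Theorem theorem4p1 (R : realType) (d dX dY : measure_display)
    (T : measurableType d) (TX : measurableType dX) (TY : measurableType dY)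
    (singletonX : forall x : TX, measurable [set x])
    (singletonY : forall y : TY, measurable [set y])
    (P : probability T R) (X : {RV P >-> TX})
    (mu : {sigma_finite_measure set TX -> \bar R})
    (X_ac : distribution P X `<< mu)
    (p : R) (p_ge1 : (1 <= p)%R) (Sigma_fin : Sigma X mu p < +oo)
    (rho : TX * TY -> \bar R) (rho_distortion : distortion rho)
    (k m c : R) (delta0 : \bar R) (k_gt0 : (0 < k)%R) (m_gt0 : (0 < m)%R)
    (mu_subregular :
      subregular mu (fun z => rho z `^ k^-1) m c delta0)
    (n : nat) (n_gt0 : (0 < n)%N) :
  quantization_error X rho n >= lower_bound (Sigma X mu p) p k m c delta0 n.
Proof.
move: rho_distortion mu_subregular.
move=> [rho_ge0 mrho] [_ c_gt0 delta0_gt0 mu_sub].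
apply/ereal_infP => _ [f [mf fn] <-].
pose h x := rho (x, f x).
have mh : measurable_fun [set: TX] h.
  by apply: measurableT_comp mrho _; exact: measurable_fun_pair.
have int_ge0 : 0 <= \int[P]_w rho (X w, f (X w)) by exact: integral_ge0.
have S_ge0 : 0 <= Sigma X mu p by exact: Lnorm_ge0.
have S_fin : Sigma X mu p \is a fin_num by rewrite ge0_fin_numE.
pose sigma := fine (Sigma X mu p).
have SE : Sigma X mu p = sigma%:E by rewrite fineK.
have p_gt0 : (0 < p)%R by exact: lt_le_trans p_ge1.
rewrite /lower_bound SE poweR_EFin -!EFinM.
set s := (_ * _ * _)%R.
have s_ge0 : (0 <= s)%R by rewrite !mulr_ge0 ?powR_ge0.
(* With 0 `^ b = 0 for b != 0, even negative, the bound is 0 when sigma = 0. *)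
have [sigma0|sigma_neq0] := eqVneq sigma 0%R.
  have -> : s = 0%R.
    rewrite /s sigma0 powR0 ?mulr0 ?mul0r// oppr_eq0 gt_eqF//.
    by rewrite divr_gt0// mulr_gt0.
  by rewrite min_l ?mul0e// poweR_ge0.
have sigma_gt0 : (0 < sigma)%R.
  by rewrite lt_neqAle eq_sym sigma_neq0/= fine_ge0.
have s_gt0 : (0 < s)%R by rewrite !mulr_gt0// powR_gt0// ltr0n.
(* delta0 may be infinite, but the minimum with s is a positive real. *)
pose t := fine (mine s%:E (delta0 `^ k)).
have tE : mine s%:E (delta0 `^ k) = t%:E.
  rewrite fineK// ge0_fin_numE; first by rewrite gt_min ltry.
  by rewrite le_min lee_fin s_ge0 poweR_ge0.
have t_gt0 : (0 < t)%R.
  by rewrite -lte_fin -tE lt_min lte_fin s_gt0 poweR_gt0.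
have t_le_s : (t <= s)%R by rewrite -lee_fin -tE ge_min lexx.
have t_le_delta0 : t%:E <= delta0 `^ k by rewrite -tE ge_min lexx orbT.
pose a := (m / (p * k))%R.
have a_gt0 : (0 < a)%R by rewrite divr_gt0// mulr_gt0.
rewrite tE -EFinM (_ : (m / (m + p * k) = a / (1 + a))%R); last first.
  by rewrite /a; field; rewrite ?gt_eqF ?addr_gt0 ?mulr_gt0.
apply: (@le_integral_of_cdf_powR _ _ _ _ _ a s t) => //.
- by apply: (measurableT_comp mh).
- by rewrite t_gt0.
move=> u /andP[u_gt0 ut].
have mB (g : TX -> \bar R) : measurable_fun [set: TX] g ->
    forall v : \bar R, measurable [set x | g x < v].
  by move=> mg v; rewrite -[X in measurable X]setTI;
     exact: emeasurable_fun_infty_o.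
have mrho1 y : measurable_fun [set: TX] (fun x => rho (x, y)).
  exact: measurable_fun_pair1.
pose delta := (u `^ k^-1)%R.
have delta_gt0 : (0 < delta)%R by exact: powR_gt0.
have ki_gt0 : (0 < k^-1)%R by rewrite invr_gt0.
have delta_lt : delta%:E < delta0.
  have : u%:E < delta0 `^ k by apply: lt_le_trans t_le_delta0; rewrite lte_fin.
  move: delta0_gt0; case: (delta0) => [r| _ _|//]; last by rewrite ltry.
  rewrite poweR_EFin !lte_fin => r0 ur.
  rewrite -[ltRHS]powRr1 ?(ltW r0)// -(divff (lt0r_neq0 k_gt0)) powRrM.
  by rewrite gt0_ltr_powR// nnegrE ?powR_ge0// ltW.
have muB y : mu [set x | rho (x, y) < u%:E] <= (c * delta `^ m)%:E.
  apply: le_trans (mu_sub y _ delta_gt0 delta_lt).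
  apply: le_measure; rewrite ?inE.
  - exact: mB.
  - apply: mB; apply: (measurableT_comp (measurable_poweR _)) => //.
  - move=> x /=; have := rho_ge0 (x, y).
    case: (rho (x, y)) => [r||]//; rewrite lee_fin lte_fin => r0 ru.
    rewrite poweR_EFin lte_fin gt0_ltr_powR// nnegrE//; exact: ltW.
have muA : mu [set x | h x < u%:E] <= (n%:R * (c * delta `^ m))%:E.
  rewrite EFinM.
  apply: (@measure_finite_range_section_le _ _ _ _ _ f
    (fun y => [set x | rho (x, y) < u%:E])) => //.
  - by move=> y; exact: mB.
  - exact: mB.
have mA : measurable [set x | h x < u%:E] by exact: mB.
have := dominated_measure_le_Lnorm X_ac p_ge1 mA.
rewrite -/(Sigma X mu p) SE => /le_trans; apply.
apply: (@le_trans _ _ (sigma%:E * (n%:R * (c * delta `^ m))%:E `^ p^-1)).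
  apply: lee_wpmul2l; first by rewrite lee_fin ltW.
  apply: gt0_ler_poweR => //; rewrite ?in_itv/= ?leey ?andbT//.
  - by rewrite invr_ge0 ltW.
  - by rewrite lee_fin !mulr_ge0 ?powR_ge0 ?(ltW c_gt0).
rewrite poweR_EFin -EFinM lee_fin.
exact: scaled_ball_bound_le.
Qed.
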